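(* Let $A$ be a symmetric and invertible two-level sparse matrix, i.e. $$A=\begin{bmatrix} A_{11} & A_{12,1} & A_{12,2} & \cdots & A_{12,m}\\ A_{12,1}^T & A_{22,1} & O & \cdots & O\\ A_{12,2}^T & O & A_{22,2} & \cdots & O\\ \vdots & \vdots & \vdots & \ddots & \vdots\\ A_{12,m}^T & O & O & \cdots & A_{22,m}\end{bmatrix},$$ where $A_{11}$ is $p\times p$ and, for each $1\le i\le m$, $A_{12,i}$ is $p\times q$ and $A_{22,i}$ is $q\times q$. Suppose that all $A_{22,i}$, $1\le i\le m$, are invertible. Then the following hold. (Inverse sub-blocks) The sub-blocks $A^{11}$, $A^{12,i}$, $A^{22,i}$ of $A^{-1}$ in the positions of $A_{11}$, $A_{12,i}$, $A_{22,i}$, respectively, are $$A^{11}=\left(A_{11}-\sum_{i=1}^m A_{12,i}\,A_{22,i}^{-1}\,A_{12,i}^T\right)^{-1}$$ and, for $1\le i\le m$, $$A^{12,i}=-\left(A_{22,i}^{-1}\,A_{12,i}^T\,A^{11}\right)^T,\qquad A^{22,i}=A_{22,i}^{-1}\left(I-A_{12,i}^T\,A^{12,i}\right).$$ (Determinant) $$|A|=\left|\left(A^{11}\right)^{-1}\right|\,\prod_{i=1}^m\left|A_{22,i}\right|.$$ (Linear system) For any vector $a$, partitioned into $a_1$ ($p\times1$) and $a_{2,1},\ldots,a_{2,m}$ (each $q\times 1$) conformably with $A$, the solution $x$ of $Ax=a$, partitioned in the same way into $x_1,x_{2,1},\ldots,x_{2,m}$, is $$x_1=A^{11}\left(a_1-\sum_{i=1}^m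 A_{12,i}\,A_{22,i}^{-1}\,a_{2,i}\right)\quad\text{and}\quad x_{2,i}=A_{22,i}^{-1}\left(a_{2,i}-A_{12,i}^T\,x_1\right),\quad 1\le i\le m.$$
   Context: All matrices and vectors are real; $m,p,q$ are positive integers. $O$ denotes a zero matrix and $I$ an identity matrix of appropriate size; $|M|$ denotes the determinant of a square matrix $M$. The inverse $A^{-1}$ is partitioned into blocks in the same way as $A$: $A^{11}$ ($p\times p$) is the block of $A^{-1}$ in the position of $A_{11}$, $A^{12,i}$ ($p\times q$) is the block of $A^{-1}$ in the position of $A_{12,i}$ (so that $(A^{12,i})^T$ is in the position of $A_{12,i}^T$), and $A^{22,i}$ ($q\times q$) is the block of $A^{-1}$ in the position of $A_{22,i}$. The superscripts are block labels, not powers. *)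

(* Defs.v *)
(* The field of real numbers is an arbitrary R : realType. *)
From mathcomp Require Import all_boot all_order all_algebra.
From mathcomp Require Import reals.

Set Implicit Arguments.
Unset Strict Implicit.
Unset Printing Implicit Defensive.

Import GRing.Theory.
Local Open Scope ring_scope.

Definition two_level_mx (R : realType) (m p q : nat) (A11 : 'M[R]_p)
    (A12 : 'I_m -> 'M[R]_(p, q)) (A22 : 'I_m -> 'M[R]_q) :
    'M[R]_(p + \sum_(i < m) q) :=
  block_mx A11 (\mxrow_(i < m) A12 i)
    (\mxcol_(i < m) (A12 i)^T) (\mxdiag_(i < m) A22 i).

Definition block11 (R : realType) (m p q : nat)
    (M : 'M[R]_(p + \sum_(i < m) q)) : 'M[R]_p :=
  ulsubmx M.

Definition block12 (R : realType) (m p q : nat)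
    (M : 'M[R]_(p + \sum_(i < m) q)) (i : 'I_m) : 'M[R]_(p, q) :=
  submxrow (ursubmx M) i.

Definition block22 (R : realType) (m p q : nat)
    (M : 'M[R]_(p + \sum_(i < m) q)) (i : 'I_m) : 'M[R]_q :=
  submxblock (drsubmx M) i i.

Definition subvec1 (R : realType) (m p q : nat)
    (v : 'cV[R]_(p + \sum_(i < m) q)) : 'cV[R]_p :=
  usubmx v.

Definition subvec2 (R : realType) (m p q : nat)
    (v : 'cV[R]_(p + \sum_(i < m) q)) (i : 'I_m) : 'cV[R]_q :=
  submxcol (dsubmx v) i.

(* Main.v *)
Require Import Defs.
From mathcomp Require Import all_boot all_order all_algebra.
From mathcomp Require Import reals.

Set Implicit Arguments.
Unset Strict Implicit.
Unset Printing Implicit Defensive.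

Import GRing.Theory.
Local Open Scope ring_scope.

(** The theorem is block Gaussian elimination on an arrowhead matrix.  In a
    system [A *m X = Y], block row [i] of the lower part involves only [X_1] and
    [X_(2,i)], because the lower right part is block diagonal; as [D i] is
    invertible, this row gives [X_(2,i)] from [X_1], and substituting into the
    top block row leaves [S *m X_1] alone, where [S] is the Schur complement
    (lemma [arrow_mx_solve]).

    The right-hand side [Y] may have any number of columns, so the same lemma
    serves three times.  With one column it is the linear system.  With
    [Y] the first block column of the identity, [X] is the first block column of
    the inverse, and the top row reads [S *m B11 = 1]: this proves at once that
    [S] is invertible and that [B11] is its inverse, and the other rows give the
    blocks below [B11], which are the transposes of the [B12 i] by symmetry.
    With [Y] the block column [i] of the lower half of the identity, it gives
    [B22 i].

    The determinant records the same elimination as a product: multiplying [A]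
    on the right by a unit lower triangular matrix clears the lower left part
    and puts [S] in the corner (lemma [det_arrow_mx]), so only the determinant
    of a block diagonal matrix remains (lemma [det_mxdiag]). *)

Section ArrowMatrix.

Variables (R : comUnitRingType) (m p q : nat).
Variables (P : 'M[R]_p) (Q : 'I_m -> 'M[R]_(p, q)).
Variables (L : 'I_m -> 'M[R]_(q, p)) (D : 'I_m -> 'M[R]_q).

Definition arrow_mx : 'M[R]_(p + \sum_(i < m) q) :=
  block_mx P (\mxrow_(i < m) Q i) (\mxcol_(i < m) L i) (\mxdiag_(i < m) D i).

Definition arrow_schur : 'M[R]_p := P - \sum_(i < m) Q i *m invmx (D i) *m L i.

Hypothesis D_unit : forall i, D i \in unitmx.

(** Solving block row [i] of the lower part for [submxcol (dsubmx X) i] and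
    substituting into the top block row cancels every block of [X] but the top
    one.  [X] and [Y] have [k] columns so that block columns of the inverse are
    covered as well as a single vector. *)
Lemma arrow_mx_solve k (X Y : 'M[R]_(p + \sum_(i < m) q, k)) :
    arrow_mx *m X = Y ->
  arrow_schur *m usubmx X
    = usubmx Y - \sum_(i < m) Q i *m invmx (D i) *m submxcol (dsubmx Y) i
  /\ forall i, submxcol (dsubmx X) i
       = invmx (D i) *m (submxcol (dsubmx Y) i - L i *m usubmx X).
Proof.
move=> <-.
rewrite -[X in arrow_mx *m X]vsubmxK -[dsubmx X]submxcolK.
set X1 := usubmx X; set X2 := submxcol (dsubmx X).
rewrite mul_block_col mul_mxrow_mxcol mxcol_mul mul_mxdiag_mxcol -mxcolD.
rewrite col_mxKu col_mxKd.
split=> [|i]; last by rewrite !mxcolK addrC addKr mulKmx.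
rewrite mulmxBl mulmx_suml -addrA; congr (_ + _).
rewrite -sumrB -sumrN; apply: eq_bigr => i _.
by rewrite mxcolK mulmxDr -!mulmxA mulKmx // opprD addrCA subrr addr0.
Qed.

End ArrowMatrix.

Lemma det_castmx (R : comPzRingType) n n' (e : n = n') (M : 'M[R]_n) :
  \det (castmx (e, e) M) = \det M.
Proof. by case: n' / e; rewrite castmx_id. Qed.

(** Peeling off the first block leaves a block triangular matrix; the size
    [\sum_i q_ i] only splits up to a cast, which the determinant ignores. *)
Lemma det_mxdiag (R : comPzRingType) m (q_ : 'I_m -> nat)
    (D : forall i, 'M[R]_(q_ i)) :
  \det (\mxdiag_i D i) = \prod_i \det (D i).
Proof.
elim: m => [|m IHm] in q_ D *.
  rewrite [RHS]big_ord0 [X in \det X](_ : _ = 1%:M) ?det1 //.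
  by apply/mxblockP => -[].
by rewrite mxdiag_recl det_castmx det_ublock IHm big_ord_recl.
Qed.

(** Block column elimination: a unit lower triangular factor, of determinant 1,
    makes the matrix block upper triangular with the Schur complement in the
    corner. *)
Lemma det_arrow_mx (R : comUnitRingType) m p q (P : 'M[R]_p)
    (Q : 'I_m -> 'M[R]_(p, q)) (L : 'I_m -> 'M[R]_(q, p)) (D : 'I_m -> 'M[R]_q) :
    (forall i, D i \in unitmx) ->
  \det (arrow_mx P Q L D) = \det (arrow_schur P Q L D) * \prod_i \det (D i).
Proof.
move=> D_unit.
(* Right multiplication by [E] subtracts from the first block column what
   cancels the [L i]. *)
pose E : 'M[R]_(p + \sum_(i < m) q) :=
  block_mx 1%:M 0 (\mxcol_i - (invmx (D i) *m L i)) 1%:M.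
have detE : \det E = 1 by rewrite det_lblock !det1 mulr1.
rewrite -[LHS]mulr1 -[X in _ * X = _]detE -det_mulmx mulmx_block.
rewrite !mulmx0 !mulmx1 !add0r mul_mxrow_mxcol mul_mxdiag_mxcol -mxcolD.
have -> : \mxcol_i (L i + D i *m - (invmx (D i) *m L i)) = 0.
  by rewrite -mxcol0; apply: eq_mxcol => i; rewrite mulmxN mulKVmx // subrr.
rewrite det_ublock det_mxdiag; congr (\det (_ + _) * _).
by rewrite -sumrN; apply: eq_bigr => i _; rewrite mulmxN mulmxA.
Qed.

Section ArrowInverse.

Variables (R : comUnitRingType) (m p q : nat).
Variables (P : 'M[R]_p) (Q : 'I_m -> 'M[R]_(p, q)).
Variables (L : 'I_m -> 'M[R]_(q, p)) (D : 'I_m -> 'M[R]_q).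
Hypothesis D_unit : forall i, D i \in unitmx.
Hypothesis A_unit : arrow_mx P Q L D \in unitmx.

Local Notation B := (invmx (arrow_mx P Q L D)).

(** Elimination applied to the first block column of [A *m A^-1 = 1], whose lower
    right-hand blocks vanish.  The first equation is what makes the Schur
    complement invertible. *)
Lemma arrow_inv_first_column :
  arrow_schur P Q L D *m ulsubmx B = 1%:M
  /\ forall i, submxcol (dlsubmx B) i = - (invmx (D i) *m L i *m ulsubmx B).
Proof.
have /(arrow_mx_solve D_unit) : arrow_mx P Q L D *m lsubmx B = lsubmx 1%:M.
  by rewrite mulmx_lsub mulmxV.
have -> : dsubmx (lsubmx (1%:M : 'M[R]_(p + \sum_(i < m) q))) = 0.
  by rewrite scalar_mx_block block_mxEh row_mxKl col_mxKd.
have -> : usubmx (lsubmx (1%:M : 'M[R]_(p + \sum_(i < m) q))) = 1%:M.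
  by rewrite scalar_mx_block block_mxEh row_mxKl col_mxKu.
have -> : ulsubmx B = usubmx (lsubmx B) by apply/matrixP=> a b; rewrite !mxE.
have -> : dlsubmx B = dsubmx (lsubmx B) by apply/matrixP=> a b; rewrite !mxE.
case=> S1 B21; split=> [|i].
  by rewrite S1 big1 ?subr0 // => i _; rewrite submxcol0 mulmx0.
by rewrite B21 submxcol0 sub0r mulmxN mulmxA.
Qed.

(** Elimination applied to the block column [i] of [A *m A^-1 = 1] in the lower
    half: the right-hand side has an identity in block row [i]. *)
Lemma arrow_inv_diagonal i :
  submxblock (drsubmx B) i i
    = invmx (D i) *m (1%:M - L i *m submxrow (ursubmx B) i).
Proof.
have /(arrow_mx_solve D_unit) [_ /(_ i)] :
    arrow_mx P Q L D *m submxrow (rsubmx B) i = submxrow (rsubmx 1%:M) i.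
  by rewrite mul_submxrow mulmx_rsub mulmxV.
have blockE (M : 'M[R]_(p + \sum_(i < m) q)) :
    submxcol (dsubmx (submxrow (rsubmx M) i)) i = submxblock (drsubmx M) i i.
  by apply/matrixP => a b; rewrite !mxE.
rewrite !blockE scalar_mx_block block_mxKdr -mxdiagZ mxblockK eqxx conform_mx_id.
move->; congr (_ *m (_ - _ *m _)).
by apply/matrixP => a b; rewrite !mxE.
Qed.

End ArrowInverse.

Theorem theorem1 (R : realType) (m p q : nat)
  (m_gt0 : (0 < m)%N) (p_gt0 : (0 < p)%N) (q_gt0 : (0 < q)%N)
  (A11 : 'M[R]_p) (A12 : 'I_m -> 'M[R]_(p, q)) (A22 : 'I_m -> 'M[R]_q)
  (A : 'M[R]_(p + \sum_(i < m) q))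
  (A_two_level : A = two_level_mx A11 A12 A22)
  (A_sym : A^T = A)
  (A_unit : A \in unitmx)
  (A22_unit : forall i : 'I_m, A22 i \in unitmx) :
  let B11 := block11 (invmx A) in
  let B12 := block12 (invmx A) in
  let B22 := block22 (invmx A) in
  let S := A11 - \sum_(i < m) A12 i *m invmx (A22 i) *m (A12 i)^T in
  [/\ [/\ S \in unitmx,
          B11 = invmx S,
          forall i : 'I_m, B12 i = - (invmx (A22 i) *m (A12 i)^T *m B11)^T
        & forall i : 'I_m,
            B22 i = invmx (A22 i) *m (1%:M - (A12 i)^T *m B12 i)],
      B11 \in unitmx /\
        \det A = \det (invmx B11) * \prod_(i < m) \det (A22 i)
    & forall a : 'cV[R]_(p + \sum_(i < m) q),
        (exists! x : 'cV[R]_(p + \sum_(i < m) q), A *m x = a) /\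
        (forall x : 'cV[R]_(p + \sum_(i < m) q), A *m x = a ->
           subvec1 x = B11 *m (subvec1 a
                         - \sum_(i < m) A12 i *m invmx (A22 i) *m subvec2 a i)
           /\ forall i : 'I_m,
                subvec2 x i =
                  invmx (A22 i) *m (subvec2 a i - (A12 i)^T *m subvec1 x))].
Proof.
move=> B11 B12 B22 S.
have A_arrow : A = arrow_mx A11 A12 (fun i => (A12 i)^T) A22 by [].
have A_unit' := A_unit; rewrite A_arrow in A_unit'.
have [SB11 B21] := arrow_inv_first_column A22_unit A_unit'.
have B22E i := arrow_inv_diagonal A22_unit A_unit' i.
rewrite -A_arrow -/S -/B11 in SB11 B21 B22E.
have [S_unit B11_unit] := mulmx1_unit SB11.
have B11E : B11 = invmx S by rewrite -[B11](mulKmx S_unit) SB11 mulmx1.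
split.
- split=> // i; rewrite -linearN -B21 /= tr_submxcol trmx_dlsub.
  by rewrite trmx_inv A_sym.
- split=> //; rewrite B11E invmxK {1}A_arrow; exact: det_arrow_mx.
- move=> a; split.
    exists (invmx A *m a); split=> [|x <-]; first exact: mulKVmx.
    exact: mulKmx.
  move=> x; rewrite {1}A_arrow => /(arrow_mx_solve A22_unit) [Sx x2].
  by split=> //; rewrite /subvec1 B11E -[usubmx x](mulKmx S_unit) Sx.
Qed.
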